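(* Subsumption of typed feature structures is not well-founded; that is, there exists an infinite decreasing sequence $A_0 \sqsupset A_1 \sqsupset A_2 \sqsupset \cdots$ of typed feature structures.
   Context: Fix non-empty, finite, disjoint sets $\mathrm{FEATS}$ (features, totally ordered) and $\mathrm{TYPES}$ (types). $\mathrm{TYPES}$ carries a partial order $\sqsubseteq$ that is bounded complete (every subset having an upper bound has a unique least upper bound), with least element $\bot$ and greatest element $\top$. Fix an infinite set $\mathrm{NODES}$, disjoint from these, with a typing function $\theta:\mathrm{NODES}\to\mathrm{TYPES}$ such that $\{q\in\mathrm{NODES}\mid\theta(q)=t\}$ is infinite for every type $t$. A typed feature structure (TFS) is a triple $A=(Q,\bar q,\delta)$ where $Q\subseteq\mathrm{NODES}$ is finite and non-empty, $\bar q\in Q$ is the root, and $\delta:Q\times\mathrm{FEATS}\to Q$ is a partial function such that every node of $Q$ is accessible from $\bar q$ via $\delta$. A TFS $A_1=(Q_1,\bar q_1,\delta_1)$ subsumes $A_2=(Q_2,\bar q_2,\delta_2)$, written $A_1\sqsubseteq A_2$, iff there is a total function $h:Q_1\to Q_2$ with (i) $h(\bar q_1)=\bar q_2$; (ii) $\theta(q)\sqsubseteq\theta(h(q))$ for all $q\in Q_1$; (iii) for every $q\in Q_1$ and every feature $f$ such that $\delta_1(q,f)$ is defined, $\delta_2(h(q),f)$ is defined and $h(\delta_1(q,f))=\delta_2(h(q),f)$. $A\sqsubset B$ (equivalently $B\sqsupset A$) means $A\sqsubseteq B$ and $A\neq B$. An order $\succ$ on a set $D$ is well-founded iff there exists no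 infinite decreasing sequence $d_0\succ d_1\succ d_2\succ\cdots$ of elements of $D$; here $\succ$ is $\sqsupset$ on the collection of TFSs. *)

(* Defs.v *)
From mathcomp Require Import all_boot all_order finmap.
From mathcomp Require Import boolp classical_sets cardinality.

Set Implicit Arguments.
Unset Strict Implicit.
Unset Printing Implicit Defensive.

Definition is_lub (d : Order.disp_t) (T : porderType d) (S : T -> Prop) (l : T) :=
  (forall t, S t -> (t <= l)%O) /\
  (forall u, (forall t, S t -> (t <= u)%O) -> (l <= u)%O).

Definition bounded_complete (d : Order.disp_t) (T : porderType d) :=
  forall S : T -> Prop,
    (exists u, forall t, S t -> (t <= u)%O) -> exists! l, is_lub S l.

Definition no_infinite_descent (D : Type) (gtD : D -> D -> Prop) :=
  ~ exists d : nat -> D, forall i, gtD (d i) (d i.+1).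

Definition delta_step (F : finType) (Q : finType)
    (delta : {ffun Q * F -> option Q}) : rel Q :=
  fun q q' => [exists f, delta (q, f) == Some q'].

(* The partial transition function is an option-valued finite function, with
   None for "undefined", and accessibility is a boolean: Leibniz equality of
   [tfs] is therefore exactly equality of the triples (Q, root, delta).
   Non-emptiness of Q is witnessed by the root. *)
Record tfs (F : finType) (N : choiceType) := TFS {
  tfs_nodes : {fset N};
  tfs_root : tfs_nodes;
  tfs_delta : {ffun tfs_nodes * F -> option tfs_nodes};
  tfs_accessible : [forall q, connect (delta_step tfs_delta) tfs_root q]
}.

Definition subsumes (F : finType) (N : choiceType) (d : Order.disp_t)
    (T : porderType d) (theta : N -> T) (A B : tfs F N) :=
  exists h : tfs_nodes A -> tfs_nodes B,
    [/\ h (tfs_root A) = tfs_root B,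
        forall q, (theta (val q) <= theta (val (h q)))%O &
        forall q f q', tfs_delta A (q, f) = Some q' ->
          tfs_delta B (h q, f) = Some (h q')].

(* [A <> B] compares triples literally, not up to renaming of nodes. *)
Definition strictly_subsumes (F : finType) (N : choiceType) (d : Order.disp_t)
    (T : porderType d) (theta : N -> T) (A B : tfs F N) :=
  subsumes theta A B /\ A <> B.

Definition strictly_subsumed_by (F : finType) (N : choiceType)
    (d : Order.disp_t) (T : porderType d) (theta : N -> T) (A B : tfs F N) :=
  strictly_subsumes theta B A.

(* Main.v *)
(** Fix pairwise distinct nodes [e 0, e 1, ...] of one common type.  The k-th
    structure is the tail [e 0 -> ... -> e k] closed by a loop at [e k], every
    feature acting as the same arrow.  Unrolling the loop once gives the next
    structure, which folds back onto the previous one by sending the two last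
    nodes to [e k], hence subsumes it.  The numbers of nodes are different, so
    the descent is strict even up to renaming of nodes. *)
Require Import Defs.
From mathcomp Require Import all_boot all_order finmap.
From mathcomp Require Import boolp classical_sets functions cardinality.
From mathcomp Require Import zify.

Set Implicit Arguments.
Unset Strict Implicit.
Unset Printing Implicit Defensive.

(** Infinitude of [S] gives an injection from [nat]. Its left inverse [r] is supplied as well, so
    that indices can be read off nodes; [r] takes the default 0 off the range of [e]. *)
Lemma infinite_set_cancel (T : choiceType) (S : set T) :
  infinite_set S ->
  exists (e : nat -> T) (r : T -> nat), cancel e r /\ forall i, S (e i).
Proof.
move=> /infiniteP/card_leP[f].
pose e i := val (f (to_setT i)).
exists e, (fun q => xget 0 [set i | e i = q]%classic); split=> i; last first.
  exact: set_valP.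
case: xgetP => [j _ /= /val_inj eji|/(_ i)/=//].
by have /(congr1 val) := inj (mem_set I) (mem_set I) eji.
Qed.

Section Lasso.
Variables (F : finType) (N : choiceType) (e : nat -> N) (r : N -> nat).
Hypothesis eK : cancel e r.

Definition lasso_nodes (k : nat) : {fset N} :=
  [fset e i | i in iota 0 k.+1]%fset.

Lemma lasso_node_subproof (k i : nat) : e (minn i k) \in lasso_nodes k.
Proof. apply/imfsetP; exists (minn i k) => //; rewrite inE mem_iota; lia. Qed.

(* Indices beyond [k] are truncated to the node [e k] carrying the loop. *)
Definition lasso_node (k i : nat) : lasso_nodes k :=
  FSetSub (lasso_node_subproof k i).

Definition lasso_index (k : nat) (q : lasso_nodes k) : nat := r (val q).

Lemma lasso_nodeK (k i : nat) : lasso_index (lasso_node k i) = minn i k.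
Proof. exact: eK. Qed.

Lemma lasso_indexK (k : nat) : cancel (@lasso_index k) (lasso_node k).
Proof.
case=> q q_in; apply: val_inj; rewrite /= /lasso_index /=.
have /imfsetP[i + ->] := q_in.
by rewrite inE mem_iota eK => i_le_k; congr e; lia.
Qed.

Lemma card_lasso_nodes (k : nat) : #|` lasso_nodes k| = k.+1.
Proof.
rewrite card_imfset; last exact: can_inj eK.
rewrite -[RHS](size_iota 0); exact: congr1 (undup_id (iota_uniq 0 k.+1)).
Qed.

Definition lasso_delta (k : nat) :
    {ffun lasso_nodes k * F -> option (lasso_nodes k)} :=
  [ffun p => Some (lasso_node k (lasso_index p.1).+1)].

(** Induction on the index of [q]: repeating one fixed feature climbs the tail, which is where a
    feature must exist. *)
Lemma lasso_accessible (k : nat) : 0 < #|F| ->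
  [forall q, connect (delta_step (lasso_delta k)) (lasso_node k 0) q].
Proof.
case/card_gt0P=> f _; apply/forallP=> q; rewrite -[q]lasso_indexK.
elim: (lasso_index q) => [|i IHi]; first exact: connect0.
apply: connect_trans IHi (connect1 _); apply/existsP; exists f.
rewrite ffunE /= lasso_nodeK; apply/eqP; congr Some; apply: val_inj => /=.
by congr e; lia.
Qed.

Hypothesis F_gt0 : 0 < #|F|.

Definition lasso (k : nat) : tfs F N := TFS (lasso_accessible k F_gt0).

Lemma lasso_strictly_subsumed (d : Order.disp_t) (T : porderType d)
    (theta : N -> T) (t : T) (k : nat) :
  (forall i, theta (e i) = t) ->
  strictly_subsumed_by theta (lasso k) (lasso k.+1).
Proof.
move=> theta_e; split; last first.
  move/(congr1 (fun A => #|` tfs_nodes A|)) => /=.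
  by rewrite !card_lasso_nodes => /eqP; rewrite eqn_leq ltnn.
(* The folding map truncates indices at [k], so [e k] and [e k.+1] both go to [e k]. *)
exists (fun q => lasso_node k (lasso_index q)); split=> /=.
- by apply: val_inj => /=; congr e; rewrite lasso_nodeK; lia.
- move=> q; rewrite theta_e -[q in leLHS]lasso_indexK /=.
  by rewrite theta_e Order.POrderTheory.lexx.
(* Truncation commutes with the arrows: min(min(i+1, k+1), k) = min(min(i, k)+1, k). *)
- move=> q f q'; rewrite !ffunE /= => -[<-]; congr Some.
  by apply: val_inj => /=; congr e; rewrite !lasso_nodeK; lia.
Qed.

End Lasso.

Theorem theorem2p3p5
  (dF : Order.disp_t) (FEATS : finOrderType dF) (hF : 0 < #|FEATS|)
  (dT : Order.disp_t) (TYPES : finTBPOrderType dT)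
  (hT : bounded_complete TYPES)
  (NODES : choiceType) (hN : infinite_set [set: NODES]%classic)
  (theta : NODES -> TYPES)
  (htheta : forall t : TYPES, infinite_set [set q | theta q = t]%classic) :
  ~ no_infinite_descent (@strictly_subsumed_by FEATS NODES dT TYPES theta) /\
  exists A : nat -> tfs FEATS NODES,
    forall i, strictly_subsumed_by theta (A i) (A i.+1).
Proof.
suff descent : exists A : nat -> tfs FEATS NODES,
    forall i, strictly_subsumed_by theta (A i) (A i.+1).
  by split=> // /(_ descent).
(* [\bot] is just a type at hand; any fibre of [theta] would do. *)
have [e [r [eK theta_e]]] := infinite_set_cancel (htheta \bot%O).
exists (lasso eK hF) => i; exact: lasso_strictly_subsumed theta_e.
Qed.
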